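(* Let $\xi:I\to\mathbb{S}^2$ be a smooth unit-speed spherical curve, on an open interval $I$, whose geodesic curvature $\kappa$ satisfies $$\kappa=2a\langle\xi,\mathbf e\rangle+b,\qquad a\neq0,\ b\in\mathbb{R},$$ for some $\mathbf e\in\mathbb{R}^3$ with $|\mathbf e|=1$. Then: (i) the spherical angular momentum $\mathcal K=-\det(\xi,\dot\xi,\mathbf e)$ of $\xi$ (with respect to $\mathbf e$) is given by $$\mathcal K=a\langle\xi,\mathbf e\rangle^2+b\langle\xi,\mathbf e\rangle+c$$ for some $c\in\mathbb{R}$; (ii) with this $c$, $\xi$ is a critical point of the functional $\int_\xi(\kappa^2-2b\kappa+b^2-4ac)\,ds$, and so $\kappa$ satisfies the corresponding Euler–Lagrange equation $$2\ddot\kappa+\kappa^3+\bigl(2-(b^2-4ac)\bigr)\kappa-2b=0 .$$ If $b=0$, $\xi$ is an elastica under tension $\sigma=-4ac$; and if $c=0$, $\xi$ is a $\lambda$-elastic curve with $\lambda=-b$. Conversely, if $\xi$ is a critical point of the functional $$\mathcal F_\sigma^\lambda(\xi)=\int_\xi\bigl((\kappa+\lambda)^2+\sigma\bigr)\,ds,\qquad \lambda,\sigma\in\mathbb{R},$$ then there exist $a\neq0$, $b\in\mathbb{R}$ and a unit vector $\mathbf e\in\mathbb{R}^3$ such that $\kappa=2a\langle\xi,\mathbf e\rangle+b$.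
   Context: $\mathbb{S}^2\subset\mathbb{R}^3$ is the unit sphere centred at the origin; a dot denotes the derivative with respect to arc length $s$. For a unit-speed curve $\xi$ in $\mathbb{S}^2$, put $N=\xi\times\dot\xi$; the geodesic curvature $\kappa$ is defined by $\ddot\xi=-\xi+\kappa N$, i.e. $\kappa=\det(\xi,\dot\xi,\ddot\xi)$. The spherical angular momentum with respect to a unit vector $\mathbf e$ is $\mathcal K=-\det(\xi,\dot\xi,\mathbf e)=-\langle N,\mathbf e\rangle$. Critical points: for a differentiable function $P$, the critical points of $\int_\xi P(\kappa)\,ds$ (acting on spherical curves with suitable boundary conditions) are characterized by the Euler–Lagrange equation $$(\kappa^2+1)P'(\kappa)+\frac{d^2}{ds^2}\bigl(P'(\kappa)\bigr)=\kappa P(\kappa);$$ ''critical point'' is to be understood as ''unit-speed curve whose curvature satisfies this equation''. A unit-speed spherical curve is an elastica under tension $\sigma\in\mathbb{R}$ if $2\ddot\kappa+\kappa^3+(2-\sigma)\kappa=0$. It is a $\lambda$-elastic curve ($\lambda\in\mathbb{R}$), i.e. a critical point of $\int_\xi(\kappa+\lambda)^2ds$, if $2\ddot\kappa+\kappa^3+(2-\lambda^2)\kappa+2\lambda=0$. *)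

(* Defs.v *)
From HB Require Import structures.
From mathcomp Require Import all_boot all_order all_algebra.
From mathcomp Require Import all_classical all_reals all_analysis.
Set Implicit Arguments.
Unset Strict Implicit.
Unset Printing Implicit Defensive.
Import Order.TTheory GRing.Theory Num.Theory.
Import numFieldNormedType.Exports.
Local Open Scope classical_set_scope.
Local Open Scope ring_scope.

Section SphericalCurves.
Variable R : realType.

(* The library norm `|u| on row vectors is the max norm, hence an explicit
   Euclidean inner product and norm; both norms induce the same derivatives. *)
Definition dot (u v : 'rV[R]_3) : R := \sum_(i < 3) u 0 i * v 0 i.

Definition enorm (u : 'rV[R]_3) : R := Num.sqrt (dot u u).

Definition det3 (u v w : 'rV[R]_3) : R :=
  \det (\matrix_(i < 3) tnth [tuple u; v; w] i).

Definition open_interval (I : set R) : Prop :=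
  [/\ I !=set0, open I & is_interval I].

(* Curves are total functions on R of which only the values on the open set I
   matter: derivatives at points of I only depend on the restriction to I. *)
Definition smooth_on (I : set R) (xi : R -> 'rV[R]_3) : Prop :=
  forall (n : nat) (s : R), I s -> derivable (derive1n n xi) s 1.

Definition unit_speed_spherical (I : set R) (xi : R -> 'rV[R]_3) : Prop :=
  [/\ open_interval I, smooth_on I xi,
      forall s, I s -> enorm (xi s) = 1
    & forall s, I s -> enorm (derive1 xi s) = 1].

(* This is the kappa of  xi'' = - xi + kappa (xi x xi'). *)
Definition geodesic_curvature (xi : R -> 'rV[R]_3) (s : R) : R :=
  det3 (xi s) (derive1 xi s) (derive1n 2 xi s).

Definition angular_momentum (xi : R -> 'rV[R]_3) (e : 'rV[R]_3) (s : R) : R :=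
  - det3 (xi s) (derive1 xi s) e.

(* Critical points of xi |-> \int_xi P(kappa) ds, in the sense of the
   Euler-Lagrange equation
     (kappa^2 + 1) P'(kappa) + (d/ds)^2 (P'(kappa)) = kappa P(kappa).
   The derivatives involved are total operators, so their existence is
   required explicitly. *)
Definition critical_point (I : set R) (xi : R -> 'rV[R]_3) (P : R -> R) : Prop :=
  let k := geodesic_curvature xi in
  let dP := fun s : R => derive1 P (k s) in
  [/\ unit_speed_spherical I xi,
      forall x, derivable P x 1
    & forall s, I s ->
      [/\ derivable dP s 1, derivable (derive1 dP) s 1
        & (k s ^+ 2 + 1) * dP s + derive1n 2 dP s = k s * P (k s)]].

Definition elastica (sigma : R) (I : set R) (xi : R -> 'rV[R]_3) : Prop :=
  let k := geodesic_curvature xi in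
  unit_speed_spherical I xi /\
  forall s, I s -> 2 * derive1n 2 k s + k s ^+ 3 + (2 - sigma) * k s = 0.

(* The variational description and the curvature equation are both part of
   the definition. *)
Definition lambda_elastic (lambda : R) (I : set R) (xi : R -> 'rV[R]_3) : Prop :=
  let k := geodesic_curvature xi in
  critical_point I xi (fun x => (x + lambda) ^+ 2) /\
  forall s, I s ->
    2 * derive1n 2 k s + k s ^+ 3 + (2 - lambda ^+ 2) * k s + 2 * lambda = 0.

End SphericalCurves.

(* Main.v *)
Require Import Defs.
From HB Require Import structures.
From mathcomp Require Import all_boot all_order all_algebra.
From mathcomp Require Import all_classical all_reals all_analysis.
From mathcomp Require Import ring lra.

(* With N = xi x xi', the Frenet equations are xi'' = - xi + k N and N' = - k xi'.
   If k = 2a<xi,e> + b, then K' = k <xi',e> = (a<xi,e>^2 + b<xi,e>)', which gives c,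
   and <xi,e>'' = - <xi,e> - k K turns into the Euler-Lagrange equation on
   writing 4aK = k^2 - b^2 + 4ac.
   Conversely, the Euler-Lagrange equation makes the vector
   V = (k + lambda) xi + k' xi' - (k^2 - lambda^2 - sigma)/2 N constant, and
   <xi,V> = k + lambda; take e = V/|V|.  If V = 0 then k is constant, and e is
   taken along the vector k xi + N, which is then constant too, with <xi,e>
   constant: b absorbs the difference, and b is in general not - lambda. *)

Set Implicit Arguments.
Unset Strict Implicit.
Unset Printing Implicit Defensive.
Import Order.TTheory GRing.Theory Num.Theory.
Import numFieldNormedType.Exports.
Local Open Scope classical_set_scope.
Local Open Scope ring_scope.

(** * Euclidean inner product, cross product and determinant in dimension three *)

Section VectorAlgebra.
Variable R : realType.
Implicit Types u v w : 'rV[R]_3.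

Lemma row3P u v :
  u 0 0 = v 0 0 -> u 0 1 = v 0 1 -> u 0 2 = v 0 2 -> u = v.
Proof.
move=> u0 u1 u2; apply/rowP => -[[|[|[|//]]] i3].
- by rewrite (_ : Ordinal i3 = 0)//; apply: val_inj.
- by rewrite (_ : Ordinal i3 = 1)//; apply: val_inj.
- by rewrite (_ : Ordinal i3 = 2)//; apply: val_inj.
Qed.

Lemma dotE u v : dot u v = u 0 0 * v 0 0 + u 0 1 * v 0 1 + u 0 2 * v 0 2.
Proof.
rewrite /dot !big_ord_recl big_ord0 addr0 addrA.
by congr (_ + u 0 _ * v 0 _ + u 0 _ * v 0 _); apply: val_inj.
Qed.

(* Indices are taken in 'I_3, that is modulo 3. *)
Definition cross u v : 'rV[R]_3 :=
  \row_i (u 0 (i + 1) * v 0 (i + 2) - u 0 (i + 2) * v 0 (i + 1)).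

Lemma crossE u v :
  (cross u v 0 0 = u 0 1 * v 0 2 - u 0 2 * v 0 1) *
  (cross u v 0 1 = u 0 2 * v 0 0 - u 0 0 * v 0 2) *
  (cross u v 0 2 = u 0 0 * v 0 1 - u 0 1 * v 0 0).
Proof.
rewrite !mxE !add0r.
have -> : 1 + 1 = 2 :> 'I_3 by apply: val_inj.
have -> : 1 + 2 = 0 :> 'I_3 by apply: val_inj.
have -> : 2 + 1 = 0 :> 'I_3 by apply: val_inj.
by have -> : 2 + 2 = 1 :> 'I_3 by apply: val_inj.
Qed.

Lemma det_mx22 (A : 'M[R]_2) : \det A = A 0 0 * A 1 1 - A 0 1 * A 1 0.
Proof.
rewrite (expand_det_row _ 0) !big_ord_recl big_ord0 addr0 /cofactor !det_mx11.
rewrite !mxE /= expr0 expr1 mul1r mulN1r mulrN.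
by congr (A _ _ * A _ _ - A _ _ * A _ _); apply: val_inj.
Qed.

(** Expansion along the third row: the cofactors of [w] are the coordinates of [cross u v]. *)
Lemma det3E u v w : det3 u v w = dot (cross u v) w.
Proof.
rewrite /det3 dotE !crossE (expand_det_row _ 2) !big_ord_recl big_ord0 addr0.
rewrite /cofactor !det_mx22 !mxE.
have -> : lift ord0 (ord0 : 'I_2) = 1 by apply: val_inj.
have -> : lift ord0 (lift ord0 (ord0 : 'I_1)) = 2 by apply: val_inj.
have -> : ord0 = 0 :> 'I_3 by apply: val_inj.
have -> : lift (2 : 'I_3) (0 : 'I_2) = 0 by apply: val_inj.
have -> : lift (2 : 'I_3) (1 : 'I_2) = 1 by apply: val_inj.
have -> : lift (1 : 'I_3) (0 : 'I_2) = 0 by apply: val_inj.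
have -> : lift (1 : 'I_3) (1 : 'I_2) = 2 by apply: val_inj.
have -> : lift (0 : 'I_3) (1 : 'I_2) = 2 by apply: val_inj.
(* Reducing the cofactor exponents modulo 2 lets the signs compute. *)
by rewrite !(tnth_nth 0) /= -signr_odd -[in X in _ + X]signr_odd /=; ring.
Qed.

Lemma dotC u v : dot u v = dot v u.
Proof. by rewrite !dotE; ring. Qed.

Lemma dotDl u v w : dot (u + v) w = dot u w + dot v w.
Proof. by rewrite !dotE !mxE; ring. Qed.

Lemma dotZl (a : R) u v : dot (a *: u) v = a * dot u v.
Proof. by rewrite !dotE !mxE; ring. Qed.

Lemma dotNl u v : dot (- u) v = - dot u v.
Proof. by rewrite -scaleN1r dotZl mulN1r. Qed.

Lemma dotDr u v w : dot u (v + w) = dot u v + dot u w.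
Proof. by rewrite dotC dotDl !(dotC u). Qed.

Lemma dotZr (a : R) u v : dot u (a *: v) = a * dot u v.
Proof. by rewrite dotC dotZl dotC. Qed.

Lemma dotvv_ge0 u : 0 <= dot u u.
Proof. by rewrite dotE !addr_ge0// -expr2 sqr_ge0. Qed.

Lemma dotvv_eq0 u : dot u u = 0 -> u = 0.
Proof.
move=> /eqP; rewrite dotE -!expr2.
rewrite !paddr_eq0 ?addr_ge0 ?sqr_ge0// !sqrf_eq0.
by move=> /andP[/andP[/eqP u0 /eqP u1] /eqP u2]; apply: row3P; rewrite mxE.
Qed.

Lemma enormE u : enorm u ^+ 2 = dot u u.
Proof. by rewrite sqr_sqrtr// dotvv_ge0. Qed.

Lemma crossC u v : cross u v = - cross v u.
Proof. by apply: row3P; rewrite [RHS]mxE !crossE; ring. Qed.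

Lemma crossvv u : cross u u = 0.
Proof. by apply: row3P; rewrite [RHS]mxE !crossE; ring. Qed.

Lemma crossDr u v w : cross u (v + w) = cross u v + cross u w.
Proof. by apply: row3P; rewrite [RHS]mxE !crossE !mxE; ring. Qed.

Lemma crossZr (a : R) u v : cross u (a *: v) = a *: cross u v.
Proof. by apply: row3P; rewrite [RHS]mxE !crossE !mxE; ring. Qed.

Lemma crossNr u v : cross u (- v) = - cross u v.
Proof. by rewrite -scaleN1r crossZr scaleN1r. Qed.

(** The vector triple product formula, a polynomial identity in each coordinate. *)
Lemma cross_crossr u v w : cross u (cross v w) = dot u w *: v - dot u v *: w.
Proof. by apply: row3P; rewrite ![in RHS]mxE !crossE !dotE; ring. Qed.

Lemma dot_crossl u v : dot (cross u v) u = 0.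
Proof. by rewrite dotE !crossE; ring. Qed.

Lemma dot_cross_cross u v :
  dot (cross u v) (cross u v) = dot u u * dot v v - dot u v ^+ 2.
Proof. by rewrite !dotE !crossE; ring. Qed.

(** With [n = cross u v], the product [cross n (cross w n)] is computed in two ways. The triple
    product formula applied outside gives [w - dot n w *: n]; applied to the inner factor
    [cross w (cross u v)], with [cross n u = v] and [cross n v = - u], it gives the components along
    [u] and [v]. *)
Lemma orthonormal_expansion u v w :
    dot u u = 1 -> dot v v = 1 -> dot u v = 0 ->
  w = dot w u *: u + dot w v *: v + dot w (cross u v) *: cross u v.
Proof.
move=> uu vv uv; set n := cross u v.
have nn : dot n n = 1 by rewrite dot_cross_cross uu vv uv expr0n mulr1 subr0.
have nu : cross n u = v.
  by rewrite crossC cross_crossr uv uu scale0r sub0r scale1r opprK.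
have nv : cross n v = - u.
  by rewrite crossC cross_crossr vv (dotC v) uv scale0r subr0 scale1r.
have := cross_crossr n w n; rewrite [cross w n]cross_crossr.
rewrite crossDr crossNr !crossZr nu nv nn scale1r scalerN opprK (dotC n).
move=> /eqP; rewrite eq_sym subr_eq => /eqP {1}->.
by rewrite [X in X + _]addrC.
Qed.

End VectorAlgebra.

(** * Differentiation of real and vector functions of one real variable *)

Section CurveCalculus.
Variable R : realType.
Implicit Types (I : set R) (s : R).

Lemma is_derive_derive1 (V : normedModType R) (f : R -> V) s :
  derivable f s 1 -> is_derive s 1 f (derive1 f s).
Proof. by move=> df; rewrite derive1E; exact: derivableP. Qed.

Lemma derive1_val (V : normedModType R) (f : R -> V) s df :
  is_derive s 1 f df -> derive1 f s = df.
Proof. by move=> fdf; rewrite derive1E derive_val. Qed.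

(** As [I] is open, agreement on [I] is agreement near [s]. This is how identities known only on [I]
    get differentiated. *)
Lemma is_derive_eq_on (V : normedModType R) I (f g : R -> V) s df :
    open I -> I s -> (forall t, I t -> f t = g t) ->
  is_derive s 1 f df -> is_derive s 1 g df.
Proof.
move=> oI Is fg; apply: near_eq_is_derive.
have := open_nbhs_nbhs (conj oI Is).
by apply: filterS => t /fg.
Qed.

Lemma derive_cst_on (f : R -> R) I c s df :
    open I -> I s -> (forall t, I t -> f t = c) -> is_derive s 1 f df ->
  df = 0.
Proof.
move=> oI Is fc /(is_derive_eq_on oI Is fc) /derive1_val <-.
exact: derive1_cst.
Qed.

(** Mean value theorem on the segment between the two points, which lies in [I] because [I] is an
    interval. *)
Lemma derive0_cst_on I (f : R -> R) s t :
    is_interval I -> (forall x, I x -> is_derive x 1 f 0) ->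
  I s -> I t -> f s = f t.
Proof.
move=> itvI f0; wlog st : s t / s <= t.
  by move=> H; case: (leP s t) => [/H|/ltW /H + ? ?] => [|->].
move=> Is It; have sub x : x \in `[s, t] -> I x.
  by rewrite in_itv /= => xst; exact: itvI xst.
have fd x : x \in `]s, t[ -> is_derive x 1 f 0.
  by move=> xst; apply/f0/sub; exact: subset_itv_oo_cc xst.
have [|c _] := MVT_segment st fd.
  by apply: derivable_within_continuous => x /sub/f0 [].
by rewrite mul0r => /eqP; rewrite subr_eq0 => /eqP.
Qed.

(** Reduces the rules for [dot], [cross] and scaling to rules for real functions. *)
Lemma is_derive_rowP (f : R -> 'rV[R]_3) s df :
  is_derive s 1 f df <->
  forall i, is_derive s 1 (fun t => f t 0 i) (df 0 i).
Proof.
split=> [[fs <-] i|fdf].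
  rewrite derive_mx// mxE; apply: derivableP.
  exact: (derivable_mxP f s 1).1.
have fs : derivable f s 1.
  by apply/derivable_mxP => i j; rewrite ord1; have [] := fdf j.
apply: DeriveDef => //; rewrite derive_mx//.
by apply/rowP => j; rewrite mxE derive_val.
Qed.

Lemma derive0_row_cst_on I (f : R -> 'rV[R]_3) s t :
    is_interval I -> (forall x, I x -> is_derive x 1 f 0) ->
  I s -> I t -> f s = f t.
Proof.
move=> itvI f0 Is It; apply/rowP => i.
have fi x : I x -> is_derive x 1 (fun y => f y 0 i) 0.
  by move=> /f0/is_derive_rowP/(_ i); rewrite mxE.
exact: derive0_cst_on itvI fi Is It.
Qed.

Lemma is_derive_mulr (f g : R -> R) s df dg :
    is_derive s 1 f df -> is_derive s 1 g dg ->
  is_derive s 1 (fun t => f t * g t) (df * g s + f s * dg).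
Proof.
move=> fdf gdg; apply: (is_derive_eq (is_deriveM fdf gdg)).
by rewrite addrC; congr (_ + _); rewrite [LHS]mulrC.
Qed.

Lemma is_derive_addr (V : normedModType R) (f g : R -> V) s df dg :
    is_derive s 1 f df -> is_derive s 1 g dg ->
  is_derive s 1 (fun t => f t + g t) (df + dg).
Proof. exact: is_deriveD. Qed.

Lemma is_derive_subr (V : normedModType R) (f g : R -> V) s df dg :
    is_derive s 1 f df -> is_derive s 1 g dg ->
  is_derive s 1 (fun t => f t - g t) (df - dg).
Proof. exact: is_deriveB. Qed.

Lemma is_derive_dot (f g : R -> 'rV[R]_3) s df dg :
    is_derive s 1 f df -> is_derive s 1 g dg ->
  is_derive s 1 (fun t => dot (f t) (g t)) (dot df (g s) + dot (f s) dg).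
Proof.
move=> /is_derive_rowP fdf /is_derive_rowP gdg.
rewrite (_ : (fun t => _) = fun t => f t 0 0 * g t 0 0 + f t 0 1 * g t 0 1
  + f t 0 2 * g t 0 2); last by apply/funext => t; rewrite dotE.
have m i := is_derive_mulr (fdf i) (gdg i).
apply: (is_derive_eq (is_derive_addr (is_derive_addr (m 0) (m 1)) (m 2))).
by rewrite !dotE; ring.
Qed.

Lemma is_derive_cross (f g : R -> 'rV[R]_3) s df dg :
    is_derive s 1 f df -> is_derive s 1 g dg ->
  is_derive s 1 (fun t => cross (f t) (g t)) (cross df (g s) + cross (f s) dg).
Proof.
move=> /is_derive_rowP fdf /is_derive_rowP gdg; apply/is_derive_rowP => i.
under eq_fun do rewrite mxE.
have m i j := is_derive_mulr (fdf i) (gdg j).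
apply: (is_derive_eq (is_derive_subr (m _ _) (m _ _))).
by rewrite !mxE; ring.
Qed.

Lemma is_derive_scale (a : R -> R) (f : R -> 'rV[R]_3) s da df :
    is_derive s 1 a da -> is_derive s 1 f df ->
  is_derive s 1 (fun t => a t *: f t) (da *: f s + a s *: df).
Proof.
move=> ada /is_derive_rowP fdf; apply/is_derive_rowP => i.
under eq_fun do rewrite mxE.
apply: (is_derive_eq (is_derive_mulr ada (fdf i))).
by rewrite !mxE.
Qed.

Lemma is_derive_dotl (f : R -> 'rV[R]_3) s df e :
  is_derive s 1 f df -> is_derive s 1 (fun t => dot (f t) e) (dot df e).
Proof.
move=> fdf; apply: (is_derive_eq (is_derive_dot fdf (is_derive_cst e s 1))).
by rewrite [dot _ 0]dotC -(scale0r e) dotZl mul0r addr0.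
Qed.

Lemma is_derive_affine (f : R -> R) s df (a c : R) :
  is_derive s 1 f df -> is_derive s 1 (fun t => a * f t + c) (a * df).
Proof.
move=> fdf; have ca := is_derive_cst a s 1.
apply: (is_derive_eq (is_derive_addr (is_derive_mulr ca fdf)
  (is_derive_cst c s 1))).
by rewrite mul0r add0r addr0.
Qed.

Lemma is_derive_quadratic (lambda m x : R) :
  is_derive x 1 (fun y => (y + lambda) ^+ 2 + m) (2 * (x + lambda)).
Proof.
have d := is_derive_addr (is_derive_id x 1) (is_derive_cst lambda x 1).
apply: (is_derive_eq (is_derive_addr (is_derive_mulr d d)
  (is_derive_cst m x 1))).
by rewrite /=; ring.
Qed.

End CurveCalculus.

(** * The orthonormal frame of a unit-speed spherical curve and its Frenet equations *)

Section FrenetFrame.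
Variables (R : realType) (I : set R) (xi : R -> 'rV[R]_3).
Hypothesis hxi : unit_speed_spherical I xi.

Let k := geodesic_curvature xi.
Let T := derive1 xi.
Let N s := cross (xi s) (T s).

Lemma is_derive_curve s : I s -> is_derive s 1 xi (T s).
Proof. by case: hxi => _ sm _ _ Is; apply/is_derive_derive1/(sm 0%N). Qed.

Lemma is_derive_tangent s : I s -> is_derive s 1 T (derive1n 2 xi s).
Proof. by case: hxi => _ sm _ _ Is; apply/is_derive_derive1/(sm 1%N). Qed.

Lemma dot_curve s : I s -> dot (xi s) (xi s) = 1.
Proof. by case: hxi => _ _ n1 _ /n1; rewrite -enormE => ->; rewrite expr1n. Qed.

Lemma dot_tangent s : I s -> dot (T s) (T s) = 1.
Proof. by case: hxi => _ _ _ n1 /n1; rewrite -enormE => ->; rewrite expr1n. Qed.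

(** Differentiating [dot (f t) (f t) = 1] gives twice the claimed product. It is used for both the
    curve and its tangent. *)
Lemma dot_derive_normed (f : R -> 'rV[R]_3) s df :
    I s -> (forall t, I t -> dot (f t) (f t) = 1) -> is_derive s 1 f df ->
  dot (f s) df = 0.
Proof.
case: hxi => -[_ oI _] _ _ _ Is f1 fdf.
have := derive_cst_on oI Is f1 (is_derive_dot fdf fdf).
by rewrite (dotC df) => /eqP; rewrite -mulr2n mulrn_eq0 /= => /eqP.
Qed.

Lemma dot_curve_tangent s : I s -> dot (xi s) (T s) = 0.
Proof.
by move=> Is; apply: dot_derive_normed dot_curve (is_derive_curve Is).
Qed.

(** Obtained by differentiating the orthogonality of [xi] and [T], where [T] has norm 1. *)
Lemma dot_curve_derive2 s : I s -> dot (xi s) (derive1n 2 xi s) = -1.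
Proof.
case: hxi => -[_ oI _] _ _ _ Is.
have dxT := is_derive_dot (is_derive_curve Is) (is_derive_tangent Is).
have := derive_cst_on oI Is dot_curve_tangent dxT.
by rewrite dot_tangent// => /eqP; rewrite addrC addr_eq0 => /eqP.
Qed.

(** The second derivative is expanded in the frame [xi], [T], [N]: its components are [-1], [0] and,
    by [det3E], the determinant that defines [k]. *)
Lemma frenet_tangent s : I s -> derive1n 2 xi s = - xi s + k s *: N s.
Proof.
move=> Is.
have xx := dot_curve Is; have TT := dot_tangent Is.
rewrite (orthonormal_expansion (derive1n 2 xi s) xx TT (dot_curve_tangent Is)).
rewrite [dot _ (xi s)]dotC dot_curve_derive2//.
rewrite [dot _ (T s)]dotC (dot_derive_normed Is dot_tangent (is_derive_tangent Is)).
by rewrite scale0r addr0 scaleN1r dotC -det3E.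
Qed.

(** In the product rule [cross T T] vanishes, and the first Frenet equation leaves [k] times
    [cross xi (cross xi T)], which is [- T]. *)
Lemma frenet_normal s : I s -> is_derive s 1 N (- k s *: T s).
Proof.
move=> Is; have dN := is_derive_cross (is_derive_curve Is) (is_derive_tangent Is).
apply: (is_derive_eq dN).
rewrite crossvv add0r frenet_tangent// crossDr crossNr crossvv oppr0 add0r.
rewrite crossZr cross_crossr dot_curve_tangent// dot_curve//.
by rewrite scale0r sub0r scale1r scalerN scaleNr.
Qed.

Lemma angular_momentumE e s : angular_momentum xi e s = - dot (N s) e.
Proof. by rewrite /angular_momentum det3E. Qed.

End FrenetFrame.

(** * The Euler-Lagrange equation of a quadratic integrand *)

Section CriticalPoints.
Variables (R : realType) (I : set R) (xi : R -> 'rV[R]_3).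

Let k := geodesic_curvature xi.

(** Here [P'] along the curve is [2 * k + 2 * lambda], so the two sides of the Euler-Lagrange
    equation differ by exactly the left-hand side of the curvature equation: the terms in
    [lambda * k ^+ 2] cancel and one of the two cubes remains. *)
Lemma critical_point_quadratic (lambda m : R) :
  critical_point I xi (fun x => (x + lambda) ^+ 2 + m) <->
  unit_speed_spherical I xi /\
  forall s, I s ->
    [/\ derivable k s 1, derivable (derive1 k) s 1
      & 2 * derive1n 2 k s + k s ^+ 3 + (2 - (lambda ^+ 2 + m)) * k s
          + 2 * lambda = 0].
Proof.
rewrite /critical_point -/k; cbv zeta.
have dPE x : derive1 (fun y => (y + lambda) ^+ 2 + m) x = 2 * (x + lambda).
  exact: derive1_val (is_derive_quadratic _ _ _).
have -> : (fun s => derive1 (fun x => (x + lambda) ^+ 2 + m) (k s)) =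
    fun s => 2 * k s + 2 * lambda.
  by apply/funext => s; rewrite dPE mulrDr.
set u := fun s => 2 * k s + 2 * lambda.
(* Solving for [k] lets differentiability pass from [u] back to [k], by the same rule for affine
   functions ([aux] below) that takes it from [k] to [u]. *)
have ku : k = fun s => 2^-1 * u s + - lambda.
  by apply/funext => s; rewrite /u; field.
suff H (hxi : unit_speed_spherical I xi) :
    ((forall s, I s -> derivable u s 1 /\ derivable (derive1 u) s 1) <->
     (forall s, I s -> derivable k s 1 /\ derivable (derive1 k) s 1)) /\
    ((forall s, I s -> derivable k s 1 /\ derivable (derive1 k) s 1) ->
     forall s, I s -> derive1n 2 u s = 2 * derive1n 2 k s).
  split=> [[hxi _ EL]|[hxi EL]]; have [uk kk] := H hxi.
    split=> [|s Is]; first exact: hxi.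
    have dk : forall s, I s -> derivable k s 1 /\ derivable (derive1 k) s 1.
      apply: uk.1 => t /EL[du ddu _]; split; [exact: du|exact: ddu].
    have [dks ddks] := dk _ Is; split=> //; have [_ _] := EL _ Is.
    rewrite (kk dk)// dPE => /eqP; rewrite -subr_eq0 => /eqP <-.
    by ring.
  have dk : forall s, I s -> derivable k s 1 /\ derivable (derive1 k) s 1.
    by move=> t /EL[].
  split; first exact: hxi.
    by move=> x; case: (is_derive_quadratic lambda m x).
  move=> s Is; have [dus ddus] := uk.2 dk _ Is; split=> //.
  rewrite (kk dk)// dPE; have [_ _ EL'] := EL _ Is.
  by apply/eqP; rewrite -subr_eq0 -[X in _ == X]EL'; apply/eqP; ring.
case: hxi => -[_ oI _] _ _ _.
have aux (a c : R) (f g : R -> R) : g = (fun t => a * f t + c) ->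
    (forall s, I s -> derivable f s 1 /\ derivable (derive1 f) s 1) ->
    forall s, I s -> [/\ derivable g s 1, derivable (derive1 g) s 1
      & derive1n 2 g s = a * derive1n 2 f s].
  move=> -> df s Is.
  have d1 t (It : I t) : is_derive t 1 (fun t => a * f t + c) (a * derive1 f t).
    by apply: is_derive_affine; apply: is_derive_derive1; have [] := df _ It.
  have d2 : is_derive s 1 (derive1 (fun t => a * f t + c)) (a * derive1n 2 f s).
    apply: (@is_derive_eq_on _ _ I (fun t => a * derive1 f t + 0)) => //.
      by move=> t It; rewrite (derive1_val (d1 _ It)) addr0.
    by apply: is_derive_affine; apply: is_derive_derive1; have [] := df _ Is.
  split; [by have [] := d1 _ Is|by have [] := d2|exact: derive1_val d2].
split; last first.
  by move=> dk s Is; have [] := aux 2 (2 * lambda) k u erefl dk s Is.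
split=> d s Is; first by have [] := aux _ _ _ _ ku d s Is.
by have [] := aux 2 (2 * lambda) k u erefl d s Is.
Qed.

End CriticalPoints.

(** * Curvature affine in the height over a plane: momentum, curvature equation and conserved
    vectors *)

Section LinearCurvature.
Variables (R : realType) (I : set R) (xi : R -> 'rV[R]_3).
Hypothesis hxi : unit_speed_spherical I xi.

Let k := geodesic_curvature xi.
Let T := derive1 xi.
Let N s := cross (xi s) (T s).

Lemma angular_momentum_quadratic (a b : R) e :
    (forall s, I s -> k s = 2 * a * dot (xi s) e + b) ->
  exists c, forall s, I s ->
    angular_momentum xi e s = a * dot (xi s) e ^+ 2 + b * dot (xi s) e + c.
Proof.
move=> kE; have [[[s0 Is0] _ itvI] _ _ _] := hxi.
(* The difference whose constant value is [c]. The square is written as a product to match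
   [is_derive_mulr]. *)
pose f t := angular_momentum xi e t
  - (a * (dot (xi t) e * dot (xi t) e) + b * dot (xi t) e).
have f0 s : I s -> is_derive s 1 f 0.
  move=> Is; rewrite /f; under eq_fun do rewrite angular_momentumE -mulN1r.
  have dz := is_derive_dotl e (is_derive_curve hxi Is).
  have dN := is_derive_dotl e (frenet_normal hxi Is).
  have dz2 := is_derive_affine a 0 (is_derive_mulr dz dz).
  have dbz := is_derive_affine b 0 dz.
  have dK := is_derive_affine (-1) 0 dN.
  have d := is_derive_subr dK (is_derive_addr dz2 dbz).
  (* The terms [+ 0] reproduce the shape in which [is_derive_affine] states its functions. *)
  rewrite (_ : (fun t => _) = (fun t => -1 * dot (cross (xi t) (derive1 xi t)) e
    + 0 - (a * (dot (xi t) e * dot (xi t) e) + 0 + (b * dot (xi t) e + 0)))).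
    apply: (is_derive_eq d).
    by rewrite dotZl -/k kE//; ring.
  by apply/funext => t; rewrite !addr0.
exists (f s0) => s Is; rewrite (derive0_cst_on itvI f0 Is0 Is) /f.
by ring.
Qed.

Lemma curvature_equation (a b c : R) e :
    (forall s, I s -> k s = 2 * a * dot (xi s) e + b) ->
    (forall s, I s ->
      angular_momentum xi e s = a * dot (xi s) e ^+ 2 + b * dot (xi s) e + c) ->
  forall s, I s ->
    [/\ derivable k s 1, derivable (derive1 k) s 1
      & 2 * derive1n 2 k s + k s ^+ 3 + (2 - (b ^+ 2 - 4 * a * c)) * k s
          - 2 * b = 0].
Proof.
move=> kE KE s Is; have [[_ oI _] _ _ _] := hxi.
(* Needed on all of [I]: the second derivative at [s] depends on the first one near [s]. *)
have d1 t (It : I t) : is_derive t 1 k (2 * a * dot (T t) e).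
  apply: (is_derive_eq_on oI It (fun x Ix => esym (kE x Ix))).
  exact: is_derive_affine (is_derive_dotl e (is_derive_curve hxi It)).
have d2 : is_derive s 1 (derive1 k) (2 * a * dot (derive1n 2 xi s) e).
  apply: (@is_derive_eq_on _ _ I (fun t => 2 * a * dot (T t) e + 0)) => //.
    by move=> t It; rewrite (derive1_val (d1 _ It)) addr0.
  exact: is_derive_affine (is_derive_dotl e (is_derive_tangent hxi Is)).
split; [by have [] := d1 _ Is|by have [] := d2|].
rewrite [derive1n 2 k s](derive1_val d2) (frenet_tangent hxi)//.
have := KE _ Is; rewrite angular_momentumE => /eqP; rewrite eqr_oppLR => /eqP NE.
(* With [k] and the angular momentum both polynomials in the height [z], the equation becomes a
   polynomial identity in [z]. *)
rewrite dotDl dotNl dotZl NE -/k kE//; move: (dot (xi s) e) => z.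
by ring.
Qed.

(** By the Frenet equations, the [xi] component of the derivative of [V] is [k' - k'], the [N]
    component is [k k' + h'], zero by the choice of [h], and the [T] component is
    [k'' + k + lambda - h k], half the Euler-Lagrange expression. The vector sought is the value of
    [V] at a base point. *)
Lemma critical_point_conserved (lambda sigma : R) :
    (forall s, I s ->
      [/\ derivable k s 1, derivable (derive1 k) s 1
        & 2 * derive1n 2 k s + k s ^+ 3 + (2 - (lambda ^+ 2 + sigma)) * k s
            + 2 * lambda = 0]) ->
  exists V, forall s, I s -> k s + lambda = dot (xi s) V.
Proof.
move=> EL; have [[[s0 Is0] oI itvI] _ _ _] := hxi.
pose h s := - 2^-1 * (k s * k s) + (lambda ^+ 2 + sigma) / 2.
pose V s := (k s + lambda) *: xi s + derive1 k s *: T s + h s *: N s.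
have V0 s : I s -> is_derive s 1 V 0.
  move=> Is; have [dk ddk E] := EL _ Is.
  have {}dk := is_derive_derive1 dk; have {}ddk := is_derive_derive1 ddk.
  have dh : is_derive s 1 h (- k s * derive1 k s).
    apply: (is_derive_eq (is_derive_affine _ _ (is_derive_mulr dk dk))).
    by field.
  have dl := is_derive_addr dk (is_derive_cst lambda s 1).
  have dV := is_derive_addr (is_derive_addr
    (is_derive_scale dl (is_derive_curve hxi Is))
    (is_derive_scale ddk (is_derive_tangent hxi Is)))
    (is_derive_scale dh (frenet_normal hxi Is)).
  apply: (is_derive_eq dV); rewrite (frenet_tangent hxi)//= -/k -/T -/(N s).
  (* The Euler-Lagrange equation solved for the second derivative of [k]. *)
  have -> : derive1 (derive1 k) s = - (k s ^+ 3
      + (2 - (lambda ^+ 2 + sigma)) * k s + 2 * lambda) / 2.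
    by move: E; rewrite -[derive1n 2 k s]/(derive1 (derive1 k) s); lra.
  by apply/rowP => i; rewrite !mxE /h; field.
exists (V s0) => s Is.
rewrite (derive0_row_cst_on itvI V0 Is0 Is).
rewrite !dotDr !dotZr (dot_curve hxi)// (dot_curve_tangent hxi)//.
by rewrite [dot _ (N s)]dotC dot_crossl; ring.
Qed.

(** The axis of the circle: [x *: xi + N] is constant since [N' = - x *: T], has squared norm
    [x ^+ 2 + 1], never zero, and has product [x] with [xi]. Normalizing it gives [e] and [d]. *)
Lemma constant_curvature_axis (x : R) :
    (forall s, I s -> k s = x) ->
  exists e d, enorm e = 1 /\ forall s, I s -> dot (xi s) e = d.
Proof.
move=> kx; have [[[s0 Is0] oI itvI] _ _ _] := hxi.
pose V s := x *: xi s + N s.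
have V0 s : I s -> is_derive s 1 V 0.
  move=> Is; have cx := is_derive_cst x s 1.
  have dV := is_derive_addr (is_derive_scale cx (is_derive_curve hxi Is))
    (frenet_normal hxi Is).
  by apply: (is_derive_eq dV); rewrite -/k kx// scale0r add0r scaleNr subrr.
have Vxi s : I s -> dot (xi s) (V s) = x.
  move=> Is; rewrite dotDr dotZr (dot_curve hxi)//.
  by rewrite [dot _ (N s)]dotC dot_crossl addr0 mulr1.
have VV s : I s -> dot (V s) (V s) = x ^+ 2 + 1.
  move=> Is; rewrite {1}/V dotDl dotZl Vxi// dotDr dotZr dot_crossl.
  rewrite dot_cross_cross (dot_curve hxi)// (dot_tangent hxi)//.
  by rewrite (dot_curve_tangent hxi)//; ring.
have Vcst s : I s -> V s0 = V s.
  exact: derive0_row_cst_on itvI V0 Is0.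
have x1 : 0 < x ^+ 2 + 1 by rewrite ltr_wpDl// sqr_ge0.
pose r := Num.sqrt (x ^+ 2 + 1).
have r0 : r != 0 by rewrite gt_eqF// sqrtr_gt0.
exists (r^-1 *: V s0), (r^-1 * x); split.
  rewrite /enorm dotZl dotZr VV// -[X in _ * (_ * X)]sqr_sqrtr ?(ltW x1)// -/r.
  by rewrite expr2 mulKf// mulVf// sqrtr1.
by move=> s Is; rewrite dotZr (Vcst _ Is) Vxi.
Qed.

End LinearCurvature.

Theorem theorem3p1 (R : realType) (I : set R) (xi : R -> 'rV[R]_3)
    (hxi : unit_speed_spherical I xi) :
  (forall (a b : R) (e : 'rV[R]_3),
      a != 0 -> enorm e = 1 ->
      (forall s, I s -> geodesic_curvature xi s = 2 * a * dot (xi s) e + b) ->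
      exists c : R,
        [/\ forall s, I s ->
              angular_momentum xi e s
                = a * dot (xi s) e ^+ 2 + b * dot (xi s) e + c,
            critical_point I xi
              (fun x => x ^+ 2 - 2 * b * x + b ^+ 2 - 4 * a * c)
              /\ (forall s, I s ->
                    2 * derive1n 2 (geodesic_curvature xi) s
                      + geodesic_curvature xi s ^+ 3
                      + (2 - (b ^+ 2 - 4 * a * c)) * geodesic_curvature xi s
                      - 2 * b = 0),
            b = 0 -> elastica (- (4 * a * c)) I xi
          & c = 0 -> lambda_elastic (- b) I xi])
  /\
  (forall lambda sigma : R,
      critical_point I xi (fun x => (x + lambda) ^+ 2 + sigma) ->
      exists (a b : R) (e : 'rV[R]_3),
        [/\ a != 0, enorm e = 1
          & forall s, I s ->
              geodesic_curvature xi s = 2 * a * dot (xi s) e + b]).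
Proof.
(* Completing the square brings the functional under [critical_point_quadratic], with [- b] for
   [lambda] and [- d] for [m]; [d] stands for [4 * a * c]. *)
have quadE (b d : R) : (fun x => x ^+ 2 - 2 * b * x + b ^+ 2 - d) =
    (fun x => (x + - b) ^+ 2 + - d).
  by apply/funext => x; ring.
split=> [a b e a0 e1 kE|lambda sigma /critical_point_quadratic[_ EL]].
  have [c KE] := angular_momentum_quadratic hxi kE; exists c.
  have EL := curvature_equation hxi kE KE.
  split=> //.
  - split; last by move=> s /EL[].
    rewrite quadE; apply/critical_point_quadratic; split=> // s /EL[? ? E].
    by split=> //; rewrite -[RHS]E; ring.
  - move=> b0; split=> // s /EL[_ _ E].
    by rewrite -[RHS]E b0; ring.
  - move=> c0; split; last by move=> s /EL[_ _ E]; rewrite -[RHS]E c0; ring.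
    rewrite (_ : (fun x => _) = fun x => (x + - b) ^+ 2 + 0).
      apply/critical_point_quadratic; split=> // s /EL[? ? E].
      by split=> //; rewrite -[RHS]E c0; ring.
    by apply/funext => x; rewrite addr0.
have [V kV] := critical_point_conserved hxi EL.
have [V0|V0] := eqVneq (enorm V) 0.
  have kx s : I s -> geodesic_curvature xi s = - lambda.
    move=> Is; apply/eqP; rewrite -addr_eq0 kV//.
    have -> : V = 0 by apply: dotvv_eq0; rewrite -enormE V0 expr0n.
    by rewrite dotC -(scale0r V) dotZl mul0r.
  have [e [d [e1 ed]]] := constant_curvature_axis hxi kx.
  (* Both sides are constant here, so the nonzero coefficient can be fixed as [1] and [b] makes up
     for [2 * d]. *)
  exists 1, (- lambda - 2 * d), e; split=> // s Is.
  by rewrite kx// ed//; ring.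
(* Chosen so that [2 * a] times [e] is [V] itself. *)
exists (enorm V / 2), (- lambda), ((enorm V)^-1 *: V); split.
- by rewrite mulf_neq0// invr_neq0// pnatr_eq0.
- rewrite {1}/enorm dotZl dotZr -enormE expr2 mulKf// mulVf//.
  exact: sqrtr1.
- by move=> s Is; rewrite dotZr -kV//; field.
Qed.
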